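(* Let $\mathbf{K}$ be an order-enriched, left distributive category with arbitrary non-empty joins, let $J\colon\mathbf{J}\to\mathbf{K}$ exhibit $\mathbf{J}$ as a wide subcategory of $\mathbf{K}$, let $I\colon\mathbf{I}\to\mathbf{J}$ exhibit $\mathbf{I}$ as a wide subcategory of $\mathbf{J}$, and let $q\colon M\to N$ be a monoid homomorphism. If $\mathbf{K}$ admits $q$-saturation with respect to $J$, then $\mathbf{K}$ admits $q$-saturation with respect to $J\circ I$.
   Context: Order-enriched: hom-sets partially ordered, composition monotone; arbitrary non-empty joins: hom-posets have suprema of non-empty subsets; left distributive: $f\circ(\bigvee_i g_i)=\bigvee_i f\circ g_i$. A wide subcategory inclusion is identity on objects and injective on morphisms. A monoid is a one-object category; a lax functor $\pi$ from $\mathbf{M}$ to $\mathbf{K}$ is an object $\pi(\ast)$ with endomorphisms $\pi_m$, $id\leq\pi_1$, $\pi_m\circ\pi_{m'}\leq\pi_{mm'}$. For a wide subcategory inclusion $H\colon\mathbf{H}\to\mathbf{K}$, $[\mathbf{M},\mathbf{K}]^H$ has lax functors as objects, morphisms $\pi\to\pi'$ the $f$ in $\mathbf{H}$ with $H(f)\circ\pi_m\leq\pi'_m\circ H(f)$, ordered via $H(f)\leq H(f')$. The change-of-base functor $[q,\mathbf{K}]^H\colon[\mathbf{N},\mathbf{K}]^H\to[\mathbf{M},\mathbf{K}]^H$ sends $\pi$ to $\pi\circ q$ and $f$ to $f$. $\mathbf{K}$ admits $q$-saturation with respect to $H$ if $[q,\mathbf{K}]^H$ has a left strict 2-adjoint.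 *)

(* Defs.v *)
(* Hom-sets are types with Leibniz equality, so that equality of
   morphisms of [lax_category] (pairs of a morphism and a proof) uses proof
   irrelevance. *)
From Stdlib Require Import Relations ProofIrrelevance.

Set Implicit Arguments.
Unset Strict Implicit.
Unset Printing Implicit Defensive.

Declare Scope category_scope.
Delimit Scope category_scope with cat.
Local Open Scope category_scope.

(* The type of objects is a parameter, so that two categories can have
   literally the same objects, as a category and its wide subcategories do. *)
Record category (Ob : Type) : Type := Category {
  hom : Ob -> Ob -> Type;
  idm : forall x, hom x x;
  comp : forall x y z, hom y z -> hom x y -> hom x z;
  comp_id_l : forall x y (f : hom x y), comp (idm y) f = f;
  comp_id_r : forall x y (f : hom x y), comp f (idm x) = f;
  comp_assoc : forall w x y z (h : hom y z) (g : hom x y) (f : hom w x),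
    comp h (comp g f) = comp (comp h g) f
}.

Arguments idm {Ob} c x.
Arguments comp {Ob c x y z} g f : rename.

Notation "g ∘ f" := (comp g f) (at level 40, left associativity)
  : category_scope.

Record idob_functor (Ob : Type) (C D : category Ob) : Type := IdobFunctor {
  ifmap : forall x y, hom C x y -> hom D x y;
  ifmap_id : forall x, ifmap (idm C x) = idm D x;
  ifmap_comp : forall x y z (g : hom C y z) (f : hom C x y),
    ifmap (g ∘ f) = ifmap g ∘ ifmap f
}.

Arguments ifmap {Ob C D} F {x y} f : rename.

Record wide_inclusion (Ob : Type) (C D : category Ob) : Type := WideInclusion {
  wi_functor :> idob_functor C D;
  wi_inj : forall x y (f g : hom C x y),
    ifmap wi_functor f = ifmap wi_functor g -> f = g
}.

Section IdobComposite.
Variables (Ob : Type) (B C D : category Ob).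

Lemma idob_comp_id (G : idob_functor C D) (F : idob_functor B C) x :
  ifmap G (ifmap F (idm B x)) = idm D x.
Proof. now rewrite !ifmap_id. Qed.

Lemma idob_comp_comp (G : idob_functor C D) (F : idob_functor B C) x y z
    (g : hom B y z) (f : hom B x y) :
  ifmap G (ifmap F (g ∘ f)) = ifmap G (ifmap F g) ∘ ifmap G (ifmap F f).
Proof. now rewrite !ifmap_comp. Qed.

Definition idob_comp (G : idob_functor C D) (F : idob_functor B C)
    : idob_functor B D :=
  {| ifmap := fun x y f => ifmap G (ifmap F f);
     ifmap_id := idob_comp_id G F;
     ifmap_comp := idob_comp_comp G F |}.

Lemma wide_comp_inj (G : wide_inclusion C D) (F : wide_inclusion B C) x y
    (f g : hom B x y) :
  ifmap (idob_comp G F) f = ifmap (idob_comp G F) g -> f = g.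
Proof. intro e. now apply (wi_inj (w := F)), (wi_inj (w := G)). Qed.

Definition wide_comp (G : wide_inclusion C D) (F : wide_inclusion B C)
    : wide_inclusion B D :=
  {| wi_functor := idob_comp G F; wi_inj := wide_comp_inj (G := G) (F := F) |}.

End IdobComposite.

Record order_category (Ob : Type) : Type := OrderCategory {
  oc_category :> category Ob;
  hle : forall x y, relation (hom oc_category x y);
  hle_order : forall x y, order (hom oc_category x y) (@hle x y);
  comp_mono : forall x y z (g g' : hom oc_category y z)
      (f f' : hom oc_category x y),
    hle g g' -> hle f f' -> hle (g ∘ f) (g' ∘ f')
}.

Arguments hle {Ob o x y} f g : rename.

Notation "f ≤ g" := (hle f g) (at level 70, no associativity)
  : category_scope.

Definition is_join (A : Type) (le : relation A) (S : A -> Prop) (u : A)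
    : Prop :=
  (forall a, S a -> le a u) /\
  (forall v, (forall a, S a -> le a v) -> le u v).

Definition has_nonempty_joins (Ob : Type) (K : order_category Ob) : Prop :=
  forall x y (S : hom K x y -> Prop),
    (exists g, S g) -> exists u, is_join hle S u.

(* The join on the left ranges over a non-empty set, as only those are
   required to exist. *)
Definition left_distributive (Ob : Type) (K : order_category Ob) : Prop :=
  forall x y z (f : hom K y z) (S : hom K x y -> Prop) (u : hom K x y),
    (exists g, S g) -> is_join hle S u ->
    is_join hle (fun h => exists g, S g /\ h = f ∘ g) (f ∘ u).

(* Viewing the orders as 2-cells, this is a strict 2-functor. *)
Record order_functor (A B : Type) (C : order_category A)
    (D : order_category B) : Type := OrderFunctor {
  fob :> A -> B;
  fmap : forall x y, hom C x y -> hom D (fob x) (fob y);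
  fmap_id : forall x, fmap (idm C x) = idm D (fob x);
  fmap_comp : forall x y z (g : hom C y z) (f : hom C x y),
    fmap (g ∘ f) = fmap g ∘ fmap f;
  fmap_mono : forall x y (f g : hom C x y), f ≤ g -> fmap f ≤ fmap g
}.

Arguments fmap {A B C D} F {x y} f : rename.

(* A strict 2-functor [F] with isomorphisms of posets
   [hom D (F c) d ≅ hom C c (G d)], strictly natural in [c] and [d]. *)
Record left_strict_2_adjoint (A B : Type) (C : order_category A)
    (D : order_category B) (G : order_functor D C) : Type :=
  LeftStrict2Adjoint {
  ladj :> order_functor C D;
  transpose : forall c d, hom D (ladj c) d -> hom C c (G d);
  untranspose : forall c d, hom C c (G d) -> hom D (ladj c) d;
  transposeK : forall c d (h : hom D (ladj c) d),
    untranspose (transpose h) = h;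
  untransposeK : forall c d (k : hom C c (G d)),
    transpose (untranspose k) = k;
  transpose_mono : forall c d (h h' : hom D (ladj c) d),
    h ≤ h' -> transpose h ≤ transpose h';
  untranspose_mono : forall c d (k k' : hom C c (G d)),
    k ≤ k' -> untranspose k ≤ untranspose k';
  transpose_natural : forall c c' d d' (f : hom C c' c)
      (h : hom D (ladj c) d) (g : hom D d d'),
    transpose (g ∘ h ∘ fmap ladj f) = fmap G g ∘ transpose h ∘ f
}.

(* The elements of [M] are [mon_elt M], its product is [comp] and its unit is
   [idm M tt]. *)
Definition monoid : Type := category unit.
Definition mon_elt (M : monoid) : Type := hom M tt tt.
Definition monoid_hom (M N : monoid) : Type := idob_functor M N.

Record lax_functor (M : monoid) (Ob : Type) (K : order_category Ob) : Type :=
  LaxFunctor {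
  lob : Ob;
  lact :> mon_elt M -> hom K lob lob;
  lact_id : idm K lob ≤ lact (idm M tt);
  lact_comp : forall m m' : mon_elt M, lact m ∘ lact m' ≤ lact (m ∘ m')
}.

Section LaxCategory.
Variables (M : monoid) (Ob : Type) (K : order_category Ob).
Variables (H : category Ob) (i : wide_inclusion H K).

Definition lax_hom (p p' : lax_functor M K) : Type :=
  {f : hom H (lob p) (lob p') |
    forall m : mon_elt M, ifmap i f ∘ p m ≤ p' m ∘ ifmap i f}.

Lemma lax_hom_eq (p p' : lax_functor M K) (f g : lax_hom p p') :
  proj1_sig f = proj1_sig g -> f = g.
Proof.
destruct f as [f hf], g as [g hg]; simpl; intro e; now apply subset_eq_compat.
Qed.

Lemma lax_id_spec (p : lax_functor M K) (m : mon_elt M) :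
  ifmap i (idm H (lob p)) ∘ p m ≤ p m ∘ ifmap i (idm H (lob p)).
Proof.
rewrite ifmap_id, comp_id_l, comp_id_r.
apply (ord_refl _ _ (hle_order K _ _)).
Qed.

Definition lax_id (p : lax_functor M K) : lax_hom p p :=
  exist _ (idm H (lob p)) (lax_id_spec p).

Lemma lax_comp_spec (p p' p'' : lax_functor M K) (g : lax_hom p' p'')
    (f : lax_hom p p') (m : mon_elt M) :
  ifmap i (proj1_sig g ∘ proj1_sig f) ∘ p m
    ≤ p'' m ∘ ifmap i (proj1_sig g ∘ proj1_sig f).
Proof.
destruct f as [f hf], g as [g hg]; simpl; rewrite ifmap_comp.
assert (refl : forall x y (h : hom K x y), h ≤ h)
  by (intros; apply (ord_refl _ _ (hle_order K _ _))).
apply (ord_trans _ _ (hle_order K _ _)) with (ifmap i g ∘ p' m ∘ ifmap i f).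
- rewrite <- !comp_assoc; now apply comp_mono.
- rewrite !comp_assoc; now apply comp_mono.
Qed.

Definition lax_comp (p p' p'' : lax_functor M K) (g : lax_hom p' p'')
    (f : lax_hom p p') : lax_hom p p'' :=
  exist _ (proj1_sig g ∘ proj1_sig f) (lax_comp_spec g f).

Lemma lax_comp_id_l (p p' : lax_functor M K) (f : lax_hom p p') :
  lax_comp (lax_id p') f = f.
Proof. apply lax_hom_eq, comp_id_l. Qed.

Lemma lax_comp_id_r (p p' : lax_functor M K) (f : lax_hom p p') :
  lax_comp f (lax_id p) = f.
Proof. apply lax_hom_eq, comp_id_r. Qed.

Lemma lax_comp_assoc (p0 p1 p2 p3 : lax_functor M K) (h : lax_hom p2 p3)
    (g : lax_hom p1 p2) (f : lax_hom p0 p1) :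
  lax_comp h (lax_comp g f) = lax_comp (lax_comp h g) f.
Proof. apply lax_hom_eq, comp_assoc. Qed.

Definition lax_precategory : category (lax_functor M K) :=
  {| hom := lax_hom;
     idm := lax_id;
     comp := lax_comp;
     comp_id_l := lax_comp_id_l;
     comp_id_r := lax_comp_id_r;
     comp_assoc := lax_comp_assoc |}.

Definition lax_hle (p p' : lax_functor M K) : relation (lax_hom p p') :=
  fun f f' => ifmap i (proj1_sig f) ≤ ifmap i (proj1_sig f').

Lemma lax_hle_order (p p' : lax_functor M K) :
  order (lax_hom p p') (@lax_hle p p').
Proof.
destruct (hle_order K (lob p) (lob p')) as [r t a]; split.
- intro f; apply r.
- intros f g h; apply t.
- intros f g fg gf; apply lax_hom_eq, (wi_inj (w := i)); now apply a.
Qed.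

Lemma lax_comp_mono (p p' p'' : lax_functor M K) (g g' : lax_hom p' p'')
    (f f' : lax_hom p p') :
  lax_hle g g' -> lax_hle f f' -> lax_hle (lax_comp g f) (lax_comp g' f').
Proof.
unfold lax_hle; simpl; intros hg hf; rewrite !ifmap_comp; now apply comp_mono.
Qed.

(* [M, K]^i *)
Definition lax_category : order_category (lax_functor M K) :=
  {| oc_category := lax_precategory;
     hle := lax_hle;
     hle_order := lax_hle_order;
     comp_mono := lax_comp_mono |}.

End LaxCategory.

Section ChangeOfBase.
Variables (M N : monoid) (q : monoid_hom M N).
Variables (Ob : Type) (K : order_category Ob).

Lemma restrict_id (p : lax_functor N K) :
  idm K (lob p) ≤ p (ifmap q (idm M tt)).
Proof. rewrite ifmap_id; apply lact_id. Qed.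

Lemma restrict_comp (p : lax_functor N K) (m m' : mon_elt M) :
  p (ifmap q m) ∘ p (ifmap q m') ≤ p (ifmap q (m ∘ m')).
Proof. rewrite ifmap_comp; apply lact_comp. Qed.

Definition restrict (p : lax_functor N K) : lax_functor M K :=
  {| lob := lob p;
     lact := fun m => p (ifmap q m);
     lact_id := restrict_id p;
     lact_comp := restrict_comp p |}.

Variables (H : category Ob) (i : wide_inclusion H K).

Lemma restrict_hom_spec (p p' : lax_functor N K) (f : lax_hom i p p')
    (m : mon_elt M) :
  ifmap i (proj1_sig f) ∘ restrict p m ≤ restrict p' m ∘ ifmap i (proj1_sig f).
Proof. exact (proj2_sig f (ifmap q m)). Qed.

Definition restrict_hom (p p' : lax_functor N K)
    (f : hom (lax_category N i) p p')
    : hom (lax_category M i) (restrict p) (restrict p') :=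
  exist _ (proj1_sig f : hom H (lob (restrict p)) (lob (restrict p')))
    (restrict_hom_spec f).

Lemma restrict_hom_id (p : lax_functor N K) :
  restrict_hom (idm (lax_category N i) p)
    = idm (lax_category M i) (restrict p).
Proof. now apply lax_hom_eq. Qed.

Lemma restrict_hom_comp (p p' p'' : lax_functor N K)
    (g : hom (lax_category N i) p' p'') (f : hom (lax_category N i) p p') :
  restrict_hom (g ∘ f) = restrict_hom g ∘ restrict_hom f.
Proof. now apply lax_hom_eq. Qed.

Lemma restrict_hom_mono (p p' : lax_functor N K)
    (f g : hom (lax_category N i) p p') :
  f ≤ g -> restrict_hom f ≤ restrict_hom g.
Proof. exact (fun h => h). Qed.

Definition change_of_base
    : order_functor (lax_category N i) (lax_category M i) :=
  {| fob := restrict;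
     fmap := restrict_hom;
     fmap_id := restrict_hom_id;
     fmap_comp := restrict_hom_comp;
     fmap_mono := restrict_hom_mono |}.

Definition admits_saturation : Prop :=
  inhabited (left_strict_2_adjoint change_of_base).

End ChangeOfBase.

(* Main.v *)
(* Let [e : p -> q^* s] be the unit at [p] of the left adjoint for [J], with
   [s] the saturation of [p]. The greatest endomorphism of an object, taken as
   the value at every element of [N], is a lax functor. Mapping out of [s] into
   the one on the carrier of [p] gives a retraction [r] of [e]. Both [e ∘ r]
   and the identity map [s] to the one on the carrier of [s], and they agree
   after composition with [e], so [e ∘ r = id]. Thus [e] is invertible in [J],
   and [s] may be transported along it to the carrier of [p]. The unit is then
   an identity, so transposition does not change underlying morphisms, and the
   adjunction restricts to any wide subcategory of [J]. *)
From Stdlib Require Import Relations IndefiniteDescription.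
Require Import Defs.

Set Implicit Arguments.
Unset Strict Implicit.
Unset Printing Implicit Defensive.

Local Open Scope category_scope.

(** * Greatest endomorphisms *)

Section OrderCategory.
Variables (Ob : Type) (K : order_category Ob).

Lemma hle_refl x y (f : hom K x y) : f ≤ f.
Proof. apply (ord_refl _ _ (hle_order K x y)). Qed.

Lemma hle_trans x y (f g h : hom K x y) : f ≤ g -> g ≤ h -> f ≤ h.
Proof. apply (ord_trans _ _ (hle_order K x y)). Qed.

Lemma comp_mono_l x y z (g g' : hom K y z) (f : hom K x y) :
  g ≤ g' -> g ∘ f ≤ g' ∘ f.
Proof. intro le; apply comp_mono; [exact le | apply hle_refl]. Qed.

Lemma comp_mono_r x y z (g : hom K y z) (f f' : hom K x y) :
  f ≤ f' -> g ∘ f ≤ g ∘ f'.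
Proof. apply comp_mono, hle_refl. Qed.

(** The join of all endomorphisms of [x], a family that is non-empty because it contains the
    identity. *)
Lemma greatest_endo x :
  has_nonempty_joins K -> exists t : hom K x x, forall f, f ≤ t.
Proof.
intro joins.
destruct (joins x x (fun _ => True)) as [t [ub _]].
- now exists (idm K x).
- exists t; intro f; now apply ub.
Qed.

Definition greatest_lax (N : monoid) x (t : hom K x x)
    (t_greatest : forall f, f ≤ t) : lax_functor N K :=
  {| lob := x;
     lact := fun _ => t;
     lact_id := t_greatest _;
     lact_comp := fun _ _ => t_greatest _ |}.

End OrderCategory.

(** * The unit of the adjunction and its invertibility *)

Section Adjoint.
Variables (Ob : Type) (K : order_category Ob).
Variables (Jcat : category Ob) (J : wide_inclusion Jcat K).
Variables (M N : monoid) (q : monoid_hom M N).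
Variable A : left_strict_2_adjoint (change_of_base q J).

Definition adj_unit (p : lax_functor M K) : hom Jcat (lob p) (lob (A p)) :=
  proj1_sig (transpose (idm (lax_category N J) (A p))).

(** This is naturality at the identity of [A p], since change of base keeps underlying morphisms. *)
Lemma transpose_unit (p : lax_functor M K) (p' : lax_functor N K)
    (h : hom (lax_category N J) (A p) p') :
  proj1_sig (transpose h) = proj1_sig h ∘ adj_unit p.
Proof.
pose proof (transpose_natural (idm (lax_category M J) p)
  (idm (lax_category N J) (A p)) h) as nat.
rewrite fmap_id, !comp_id_r in nat.
now rewrite nat.
Qed.

(** Uniqueness half of the universal property of the unit: transposition is injective. *)
Lemma adj_hom_ext (p : lax_functor M K) (p' : lax_functor N K)
    (h h' : hom (lax_category N J) (A p) p') :
  proj1_sig h ∘ adj_unit p = proj1_sig h' ∘ adj_unit p -> h = h'.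
Proof.
rewrite <- !transpose_unit; intro e.
rewrite <- (transposeK h), <- (transposeK h').
f_equal; now apply lax_hom_eq.
Qed.

Lemma unit_spec (p : lax_functor M K) (m : mon_elt M) :
  ifmap J (adj_unit p) ∘ p m ≤ A p (ifmap q m) ∘ ifmap J (adj_unit p).
Proof. exact (proj2_sig (transpose (idm (lax_category N J) (A p))) m). Qed.

(** Existence half: the hypothesis makes [f] a morphism into the restriction of [p'], and its
    untranspose is the lift. *)
Lemma adj_lift (p : lax_functor M K) (p' : lax_functor N K)
    (f : hom Jcat (lob p) (lob p')) :
  (forall m, ifmap J f ∘ p m ≤ p' (ifmap q m) ∘ ifmap J f) ->
  exists h : hom (lax_category N J) (A p) p', proj1_sig h ∘ adj_unit p = f.
Proof.
intro hf.
pose (k := exist _ f hf : hom (lax_category M J) p (change_of_base q J p')).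
exists (untranspose A k).
now rewrite <- transpose_unit, untransposeK.
Qed.

Definition is_inverse (C : category Ob) x y (e : hom C x y) (r : hom C y x) :
    Prop :=
  r ∘ e = idm C x /\ e ∘ r = idm C y.

Lemma adj_unit_invertible (p : lax_functor M K) :
  has_nonempty_joins K -> exists r, is_inverse (adj_unit p) r.
Proof.
intro joins.
destruct (greatest_endo (lob p) joins) as [t ht].
destruct (greatest_endo (lob (A p)) joins) as [t' ht'].
set (e := adj_unit p).
destruct (@adj_lift p (greatest_lax N ht) (idm Jcat (lob p))) as [[r hr] re].
{ intro m; simpl; rewrite ifmap_id, comp_id_l, comp_id_r; apply ht. }
simpl in r, hr, re; fold e in re.
exists r; split; [exact re |].
assert (Jre : ifmap J r ∘ ifmap J e = idm K (lob p))
  by now rewrite <- ifmap_comp, re, ifmap_id.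
(* Inserting [r ∘ e = id] gives [e ∘ t ∘ r = (e ∘ t ∘ r) ∘ (e ∘ r)], and
   [e ∘ t ∘ r] is an endomorphism of the carrier of [A p]. *)
assert (er_spec : forall n,
    ifmap J (e ∘ r) ∘ A p n ≤ greatest_lax N ht' n ∘ ifmap J (e ∘ r)).
{ intro n; simpl; rewrite ifmap_comp.
  apply hle_trans with (ifmap J e ∘ (t ∘ ifmap J r)).
  (* Laxness of [r] into the constant [t] bounds [r ∘ A p n] by [t ∘ r]. *)
  - rewrite <- comp_assoc; apply comp_mono_r, hr.
  - replace (ifmap J e ∘ (t ∘ ifmap J r))
      with (ifmap J e ∘ (t ∘ ifmap J r) ∘ (ifmap J e ∘ ifmap J r)).
    + apply comp_mono_l, ht'.
    + rewrite <- (comp_id_l (ifmap J r)) at 3; rewrite <- Jre.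
      now rewrite !comp_assoc. }
assert (id_spec : forall n, ifmap J (idm Jcat (lob (A p))) ∘ A p n
    ≤ greatest_lax N ht' n ∘ ifmap J (idm Jcat (lob (A p)))).
{ intro n; simpl; rewrite ifmap_id, comp_id_l, comp_id_r; apply ht'. }
pose (h := exist _ (e ∘ r) er_spec
  : hom (lax_category N J) (A p) (greatest_lax N ht')).
pose (h' := exist _ (idm Jcat (lob (A p))) id_spec
  : hom (lax_category N J) (A p) (greatest_lax N ht')).
assert (hh' : h = h').
{ apply adj_hom_ext; simpl; fold e.
  now rewrite <- comp_assoc, re, comp_id_l, comp_id_r. }
exact (f_equal (fun k => proj1_sig k) hh').
Qed.

(** * Transport of the saturation to the original carrier *)

Section Transport.
Variable r : forall p : lax_functor M K, hom Jcat (lob (A p)) (lob p).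
Hypothesis r_inverse : forall p, is_inverse (adj_unit p) (r p).

Lemma image_retraction (p : lax_functor M K) :
  ifmap J (r p) ∘ ifmap J (adj_unit p) = idm K (lob p).
Proof.
now rewrite <- ifmap_comp, (proj1 (r_inverse p)), ifmap_id.
Qed.

Lemma image_section (p : lax_functor M K) :
  ifmap J (adj_unit p) ∘ ifmap J (r p) = idm K (lob (A p)).
Proof.
now rewrite <- ifmap_comp, (proj2 (r_inverse p)), ifmap_id.
Qed.

Definition transport_act (p : lax_functor M K) (n : mon_elt N) :
    hom K (lob p) (lob p) :=
  ifmap J (r p) ∘ A p n ∘ ifmap J (adj_unit p).

Lemma transport_id (p : lax_functor M K) :
  idm K (lob p) ≤ transport_act p (idm N tt).
Proof.
unfold transport_act; rewrite <- image_retraction.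
apply comp_mono_l.
rewrite <- (comp_id_r (ifmap J (r p))) at 1.
apply comp_mono_r, lact_id.
Qed.

Lemma transport_comp (p : lax_functor M K) (n n' : mon_elt N) :
  transport_act p n ∘ transport_act p n' ≤ transport_act p (n ∘ n').
Proof.
unfold transport_act.
replace (ifmap J (r p) ∘ A p n ∘ ifmap J (adj_unit p) ∘
    (ifmap J (r p) ∘ A p n' ∘ ifmap J (adj_unit p)))
  with (ifmap J (r p) ∘ (A p n ∘ A p n') ∘ ifmap J (adj_unit p)).
- apply comp_mono_l, comp_mono_r, lact_comp.
(* The unit followed by [r] would cancel between the two actions; here it is inserted there. *)
- rewrite <- (comp_id_l (A p n')) at 1; rewrite <- image_section.
  now rewrite !comp_assoc.
Qed.

Definition transport (p : lax_functor M K) : lax_functor N K :=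
  {| lob := lob p;
     lact := transport_act p;
     lact_id := transport_id p;
     lact_comp := transport_comp p |}.

(** Laxness of the identity as the new unit, obtained by composing [unit_spec] with [r p] on the
    left. *)
Lemma le_transport (p : lax_functor M K) (m : mon_elt M) :
  p m ≤ transport p (ifmap q m).
Proof.
simpl; unfold transport_act.
rewrite <- (comp_id_l (p m)), <- image_retraction, <- !comp_assoc.
apply comp_mono_r, unit_spec.
Qed.

(** From left to right, the lift of [f] along the unit must be [f ∘ r p], and its laxness
    precomposed with the unit is the claim. Both conditions concern the same [f], so they can be
    compared within any wide subcategory of [Jcat]. *)
Lemma transport_universal (p : lax_functor M K) (p' : lax_functor N K)
    (f : hom Jcat (lob p) (lob p')) :
  (forall m, ifmap J f ∘ p m ≤ p' (ifmap q m) ∘ ifmap J f) <->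
  (forall n, ifmap J f ∘ transport p n ≤ p' n ∘ ifmap J f).
Proof.
split; intro hf.
- destruct (adj_lift hf) as [[g hg] ge]; simpl in g, hg, ge.
  assert (gfr : g = f ∘ r p).
  { now rewrite <- ge, <- comp_assoc, (proj2 (r_inverse p)), comp_id_r. }
  intro n; simpl; unfold transport_act.
  rewrite !comp_assoc, <- ifmap_comp, <- gfr.
  rewrite <- ge at 1; rewrite ifmap_comp, comp_assoc.
  apply comp_mono_l, hg.
- intro m.
  apply hle_trans with (ifmap J f ∘ transport p (ifmap q m)).
  + apply comp_mono_r, le_transport.
  + apply hf.
Qed.

(** * The adjunction over the smaller subcategory *)

Variables (Icat : category Ob) (I : wide_inclusion Icat Jcat).

(** The underlying morphism is reused as it is, because [transport p] has literally the carrier of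
    [p]; neither the old unit nor [r] has to lie in [Icat]. *)
Definition sub_transpose (p : lax_functor M K) (p' : lax_functor N K)
    (h : hom (lax_category N (wide_comp J I)) (transport p) p') :
    hom (lax_category M (wide_comp J I)) p (restrict q p') :=
  exist _ (proj1_sig h : hom Icat (lob p) (lob (restrict q p')))
    (proj2 (transport_universal (ifmap I (proj1_sig h))) (proj2_sig h)).

Definition sub_untranspose (p : lax_functor M K) (p' : lax_functor N K)
    (k : hom (lax_category M (wide_comp J I)) p (restrict q p')) :
    hom (lax_category N (wide_comp J I)) (transport p) p' :=
  exist _ (proj1_sig k : hom Icat (lob (transport p)) (lob p'))
    (proj1 (transport_universal (p' := p') (ifmap I (proj1_sig k)))
       (proj2_sig k)).

Lemma sub_unit_spec (p : lax_functor M K) (m : mon_elt M) :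
  ifmap (wide_comp J I) (idm Icat (lob p)) ∘ p m
    ≤ restrict q (transport p) m
        ∘ ifmap (wide_comp J I) (idm Icat (lob p)).
Proof. rewrite ifmap_id, comp_id_l, comp_id_r; apply le_transport. Qed.

Definition sub_unit (p : lax_functor M K) :
    hom (lax_category M (wide_comp J I)) p (restrict q (transport p)) :=
  exist _ (idm Icat (lob p)) (sub_unit_spec p).

(** Untransposing supplies the lax condition over [N]; the underlying morphism is [f] up to an
    identity. *)
Definition transport_hom (p p' : lax_functor M K)
    (f : hom (lax_category M (wide_comp J I)) p p') :
    hom (lax_category N (wide_comp J I)) (transport p) (transport p') :=
  sub_untranspose (sub_unit p' ∘ f).

Lemma transport_hom_val (p p' : lax_functor M K)
    (f : hom (lax_category M (wide_comp J I)) p p') :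
  proj1_sig (transport_hom f) = proj1_sig f.
Proof. apply comp_id_l. Qed.

Lemma transport_hom_id (p : lax_functor M K) :
  transport_hom (idm (lax_category M (wide_comp J I)) p)
    = idm (lax_category N (wide_comp J I)) (transport p).
Proof. apply lax_hom_eq, transport_hom_val. Qed.

Lemma transport_hom_comp (p p' p'' : lax_functor M K)
    (g : hom (lax_category M (wide_comp J I)) p' p'')
    (f : hom (lax_category M (wide_comp J I)) p p') :
  transport_hom (g ∘ f) = transport_hom g ∘ transport_hom f.
Proof.
apply lax_hom_eq; rewrite transport_hom_val; simpl.
now rewrite !comp_id_l.
Qed.

Lemma transport_hom_mono (p p' : lax_functor M K)
    (f g : hom (lax_category M (wide_comp J I)) p p') :
  f ≤ g -> transport_hom f ≤ transport_hom g.
Proof.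
simpl; unfold lax_hle; rewrite !transport_hom_val; exact (fun le => le).
Qed.

Definition transport_functor :
    order_functor (lax_category M (wide_comp J I))
      (lax_category N (wide_comp J I)) :=
  {| fob := transport;
     fmap := transport_hom;
     fmap_id := transport_hom_id;
     fmap_comp := transport_hom_comp;
     fmap_mono := transport_hom_mono |}.

Lemma transport_admits_saturation : admits_saturation q (wide_comp J I).
Proof.
constructor.
apply (@LeftStrict2Adjoint _ _ _ _ (change_of_base q (wide_comp J I))
  transport_functor sub_transpose sub_untranspose).
- intros; now apply lax_hom_eq.
- intros; now apply lax_hom_eq.
- intros p p' h h' le; exact le.
- intros p p' k k' le; exact le.
- intros; apply lax_hom_eq; simpl; now rewrite comp_id_l.
Qed.

End Transport.
End Adjoint.

Theorem theorem4p8 (Ob : Type) (K : order_category Ob)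
    (K_joins : has_nonempty_joins K) (K_dist : left_distributive K)
    (Jcat : category Ob) (J : wide_inclusion Jcat K)
    (Icat : category Ob) (I : wide_inclusion Icat Jcat)
    (M N : monoid) (q : monoid_hom M N) :
  admits_saturation q J -> admits_saturation q (wide_comp J I).
Proof.
intros [A].
(* Transport needs the inverses as a function of [p], while invertibility only asserts existence for
   each [p]; hence the choice. *)
pose (r := fun p =>
  constructive_indefinite_description _ (adj_unit_invertible A p K_joins)).
apply (@transport_admits_saturation _ K _ J _ _ q A (fun p => proj1_sig (r p))).
intro p; exact (proj2_sig (r p)).
Qed.
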